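(* Let $T$ be a complete NIP theory with monster model $\mathfrak{C}$. Let $A\subseteq\mathfrak{C}$ be a small set of cardinality $\mu$, where $|T|<\mathrm{cf}(\mu)=\kappa<\mu$. Then for every type $p(x)\in S(A)$ in finitely many variables there is some $B\subseteq A$ with $|B|<\mu$ such that $p$ does not divide over $B$. Moreover, if $A$ is a model $M$, then there is a model $N\prec M$ with $|N|<\mu$ such that $p$ is finitely satisfiable in $N$.
   Context: $T$ is NIP if no formula $\varphi(x,y)$ has the independence property, i.e. there are no $\langle a_i:i<\omega\rangle$ and $\langle b_s:s\subseteq\omega\rangle$ with $\models\varphi(a_i,b_s)\iff i\in s$. A type $p$ divides over $B$ if some formula $\varphi(x,c)\in p$ divides over $B$, i.e. there is a $B$-indiscernible sequence $\langle c_i:i<\omega\rangle$ with $c_0=c$ and $\{\varphi(x,c_i):i<\omega\}$ inconsistent. A type $p$ is finitely satisfiable in $N$ if every formula in $p$ is realized by some tuple from $N$. *)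

(* Defs.v *)
From mathcomp Require Import all_boot.
From mathcomp Require Import boolp classical_sets functions cardinality.

Set Implicit Arguments.
Unset Strict Implicit.
Unset Printing Implicit Defensive.

Local Open Scope classical_set_scope.
Local Open Scope card_scope.

Definition card_lt (T U : Type) (A : set T) (B : set U) : Prop :=
  A #<= B /\ ~ (B #<= A).

(* A cardinal is an initial ordinal: a well-ordered type each of whose proper
   initial segments has strictly smaller cardinality. *)
Record cardinal : Type := Cardinal {
  card_sort :> Type ;
  olt : card_sort -> card_sort -> Prop ;
  olt_wf : well_founded olt ;
  olt_trans : forall x y z, olt x y -> olt y z -> olt x z ;
  olt_total : forall x y, olt x y \/ x = y \/ olt y x ;
  olt_initial : forall x, card_lt [set y | olt y x] [set: card_sort]
}.

Definition unbounded (mu : cardinal) (X : set mu) : Prop :=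
  forall m, exists2 x, X x & m = x \/ olt m x.

Definition is_cofinality (mu kappa : cardinal) : Prop :=
  (exists2 X : set mu, unbounded X & X #= [set: kappa]) /\
  (forall X : set mu, unbounded X -> [set: kappa] #<= X).

Record language : Type := Language {
  fsym : Type ;
  farity : fsym -> nat ;
  rsym : Type ;
  rarity : rsym -> nat
}.

Inductive term (L : language) (V : Type) : Type :=
| Var (v : V)
| App (f : fsym L) (t : 'I_(farity f) -> term L V).
Arguments Var {L V} v.
Arguments App {L V} f t.

(* Formulas with free variables in V; under a quantifier, None is the bound
   variable. *)
Inductive formula (L : language) (V : Type) : Type :=
| Bot
| Eq (s t : term L V)
| Rel (r : rsym L) (t : 'I_(rarity r) -> term L V)
| Imp (phi psi : formula L V)
| All (phi : formula L (option V)).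
Arguments Bot {L V}.
Arguments Eq {L V} s t.
Arguments Rel {L V} r t.
Arguments Imp {L V} phi psi.
Arguments All {L V} phi.

Definition Not (L : language) (V : Type) (phi : formula L V) : formula L V := Imp phi Bot.

Fixpoint term_rename (L : language) (V W : Type) (g : V -> W) (t : term L V) : term L W :=
  match t with
  | Var v => Var (g v)
  | App f u => App f (fun i => term_rename g (u i))
  end.

Fixpoint rename (L : language) (V W : Type) (g : V -> W) (phi : formula L V) : formula L W :=
  match phi with
  | Bot => Bot
  | Eq s t => Eq (term_rename g s) (term_rename g t)
  | Rel r t => Rel r (fun i => term_rename g (t i))
  | Imp phi psi => Imp (rename g phi) (rename g psi)
  | All phi => All (rename (omap g) phi)
  end.

Record structure (L : language) : Type := Structure {
  dom :> Type ;
  dom_inhabited : inhabited dom ;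
  fint : forall f : fsym L, ('I_(farity f) -> dom) -> dom ;
  rint : forall r : rsym L, ('I_(rarity r) -> dom) -> Prop
}.

Fixpoint eval (L : language) (M : structure L) (V : Type) (v : V -> M) (t : term L V) : M :=
  match t with
  | Var x => v x
  | App f u => fint (fun i => eval v (u i))
  end.

Definition extend (M V : Type) (v : V -> M) (x : M) (o : option V) : M :=
  if o is Some y then v y else x.

Fixpoint sat (L : language) (M : structure L) (V : Type) (phi : formula L V)
    (v : V -> M) : Prop :=
  match phi with
  | Bot => False
  | Eq s t => eval v s = eval v t
  | Rel r t => rint (fun i => eval v (t i))
  | Imp phi psi => sat phi v -> sat psi v
  | All phi => forall x : M, sat phi (extend v x)
  end.

Definition sentence (L : language) : Type := formula L void.

Definition theory (L : language) : Type := set (sentence L).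

Definition holds L (M : structure L) (s : sentence L) : Prop :=
  sat s (of_void M).

Definition models L (M : structure L) (T : theory L) : Prop :=
  forall s, T s -> holds M s.

Definition entails L (T : theory L) (s : sentence L) : Prop :=
  forall M : structure L, models M T -> holds M s.

Definition complete_theory L (T : theory L) : Prop :=
  (exists M : structure L, models M T) /\
  (forall s, entails T s \/ entails T (Not s)).

(* |T| is, as usual, the number of L-formulas (in the variables v_0, v_1, ...),
   that is |L| + aleph_0, whatever axioms are chosen for T. *)
Definition formulas (L : language) : set (formula L nat) := [set: formula L nat].
Arguments formulas L : clear implicits.

Section Types.
Variables (L : language) (C : structure L).

(* Formulas in x_0, ..., x_{n-1} with parameters from C. *)
Definition pformula (n : nat) : Type := formula L ('I_n + C).

Definition inst n m (phi : formula L ('I_n + 'I_m)) (c : 'I_m -> C) :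
    pformula n :=
  rename (fun v => match v with inl i => inl i | inr j => inr (c j) end) phi.

(* C |= theta(a), each parameter being interpreted by itself. *)
Definition psat n (theta : pformula n) (a : 'I_n -> C) : Prop :=
  sat theta (fun v => match v with inl i => a i | inr c => c end).

(* The L(A)-formulas in n variables. *)
Definition pformulas_over n (A : set C) : set (pformula n) :=
  [set theta | exists m (phi : formula L ('I_n + 'I_m)) (c : 'I_m -> C),
     (forall j, A (c j)) /\ theta = inst phi c].

(* Consistency with the elementary diagram of C. *)
Definition consistent n (S : set (pformula n)) : Prop :=
  forall F : set (pformula n), finite_set F -> F `<=` S ->
    exists a : 'I_n -> C, forall theta, F theta -> psat theta a.

(* p \in S_n(A) *)
Definition complete_type n (A : set C) (p : set (pformula n)) : Prop :=
  [/\ p `<=` pformulas_over A,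
      consistent p &
      forall theta, pformulas_over A theta -> p theta \/ p (Not theta)].

Definition realizes n (a : 'I_n -> C) (p : set (pformula n)) : Prop :=
  forall theta, p theta -> psat theta a.

Definition saturated (kbar : cardinal) : Prop :=
  forall (A : set C), card_lt A [set: kbar] ->
  forall n (p : set (pformula n)), complete_type A p ->
    exists a : 'I_n -> C, realizes a p.

Definition partial_elementary (A : set C) (f : C -> C) : Prop :=
  forall k (phi : formula L 'I_k) (a : 'I_k -> C), (forall i, A (a i)) ->
    sat phi a <-> sat phi (f \o a).

Definition automorphism (f : C -> C) : Prop :=
  [/\ bijective f,
      forall (g : fsym L) (a : 'I_(farity g) -> C),
        f (fint a) = fint (f \o a) &
      forall (r : rsym L) (a : 'I_(rarity r) -> C),
        rint a <-> rint (f \o a)].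

Definition strongly_homogeneous (kbar : cardinal) : Prop :=
  forall (A : set C) (f : C -> C), card_lt A [set: kbar] ->
    partial_elementary A f ->
    exists2 g, automorphism g & forall x, A x -> g x = f x.

(* A monster model of T; kbar is the bound below which sets are small. *)
Definition monster (T : theory L) (kbar : cardinal) : Prop :=
  [/\ models C T, saturated kbar & strongly_homogeneous kbar].

Definition small (kbar : cardinal) (A : set C) : Prop :=
  card_lt A [set: kbar].

Definition independence_property n m (phi : formula L ('I_n + 'I_m)) : Prop :=
  exists (a : nat -> 'I_n -> C) (b : set nat -> 'I_m -> C),
    forall i s, psat (inst phi (b s)) (a i) <-> s i.

Definition NIP : Prop :=
  forall n m (phi : formula L ('I_n + 'I_m)), ~ independence_property phi.

Definition increasing k (i : 'I_k -> nat) : Prop :=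
  forall s t : 'I_k, s < t -> i s < i t.

Definition indiscernible (B : set C) m (c : nat -> 'I_m -> C) : Prop :=
  forall k l (psi : formula L ('I_k * 'I_m + 'I_l)) (b : 'I_l -> C),
    (forall j, B (b j)) ->
  forall i j : 'I_k -> nat, increasing i -> increasing j ->
  let val (h : 'I_k -> nat) v :=
    match v with inl (s, t) => c (h s) t | inr u => b u end in
  sat psi (val i) <-> sat psi (val j).

(* phi(x, c) divides over B. *)
Definition formula_divides n m (phi : formula L ('I_n + 'I_m)) (c : 'I_m -> C)
    (B : set C) : Prop :=
  exists cs : nat -> 'I_m -> C,
    [/\ indiscernible B cs,
        cs 0 = c &
        ~ consistent [set inst phi (cs i) | i in [set: nat]]].

Definition divides n (p : set (pformula n)) (B : set C) : Prop :=
  exists m (phi : formula L ('I_n + 'I_m)) (c : 'I_m -> C),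
    p (inst phi c) /\ formula_divides phi c B.

Definition finitely_satisfiable_in n (p : set (pformula n)) (N : set C) : Prop :=
  forall theta, p theta ->
    exists2 a : 'I_n -> C, (forall i, N (a i)) & psat theta a.

Record substructure : Type := Substructure {
  univ :> set C ;
  univ_nonempty : inhabited univ ;
  univ_closed : forall (f : fsym L) (a : 'I_(farity f) -> C),
    (forall i, univ (a i)) -> univ (fint a)
}.

Definition induced_fint (N : substructure) (f : fsym L)
    (a : 'I_(farity f) -> univ N) : univ N :=
  exist _ (fint (fun i => \val (a i)))
    (mem_set (univ_closed (fun i => set_valP (a i)))).

Definition induced (N : substructure) : structure L :=
  @Structure L (univ N) (univ_nonempty N) (@induced_fint N)
    (fun r a => rint (fun i => \val (a i))).

End Types.

Definition elementary_map L (N M : structure L) (f : N -> M) : Prop :=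
  forall k (phi : formula L 'I_k) (v : 'I_k -> N),
    sat phi v <-> sat phi (f \o v).

(* M is a model in the monster sense: M is an elementary substructure of C. *)
Definition is_model L (C : structure L) (M : substructure C) : Prop :=
  @elementary_map L (induced M) C (fun x => \val x).

Definition incl (T : Type) (N M : set T) (NM : N `<=` M) (x : N) : M :=
  exist _ (\val x) (mem_set (NM _ (set_valP x))).

Definition elementary_sub L (C : structure L) (N M : substructure C) : Prop :=
  exists NM : univ N `<=` univ M,
    @elementary_map L (induced N) (induced M) (incl NM).

(* Main.v *)
(* Say that a base B is isolating for p if every formula of p is implied by some
   consistent formula over B, not necessarily one of p.  Over such a B no
   formula phi(x, c) of p divides, since the isolating formula implies all the
   phi(x, c_i) along an indiscernible sequence; and any elementary N containing
   B realizes the isolating formulas, hence all of p.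

   Suppose that no B of size < mu is isolating.  Write A as an increasing union
   of segments A_alpha, alpha < mu.  As |T| < cf(mu) = kappa < mu, a union of
   kappa finite sets and one segment is small, and this yields one formula phi
   such that for each alpha some beta works for all finite X: there is c in
   A_beta with phi(x, c) in p such that every consistent formula over A_alpha
   and X is consistent with ~ phi(x, c).  Iterating gives levels
   E_0 <= E_1 <= ... of A.  Choosing c_(N-1), ..., c_0 downwards, c_k in E_(k+1)
   relative to E_k and the parameters already chosen, all sign patterns on the
   phi(x, c_k) are consistent: a positive phi(x, c_k) lies in p over E_(k+1),
   which was treated before, and a negative one is allowed by the choice of
   c_k.  Saturation then gives the independence property. *)
From Stdlib Require List.
Require Import Defs.
From mathcomp Require Import all_boot.
From mathcomp Require Import boolp classical_sets functions cardinality filter.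

Set Implicit Arguments.
Unset Strict Implicit.
Unset Printing Implicit Defensive.

Local Open Scope classical_set_scope.
Local Open Scope card_scope.

(** * Cardinal arithmetic *)

Lemma card_le_injP (T U : Type) (A : set T) (u0 : U) :
  A #<= [set: U] <-> exists h : T -> U, set_inj A h.
Proof.
split=> [/card_leP[f]|[h hinj]]; last first.
  apply: card_le_trans (card_leT (h @` A)).
  by have := inj_card_eq hinj; rewrite card_eq_le => /andP[].
exists (fun x => if pselect (A x) is left Ax then \val (f (exist _ x (mem_set Ax))) else u0).
move=> x y /set_mem Ax /set_mem Ay; case: pselect => // Ax'; case: pselect => // Ay' /val_inj.
by move/(@inj _ _ _ f) => /(_ (mem_set I) (mem_set I)) [].
Qed.

Lemma card_leT_injP (X Y : Type) :
  [set: X] #<= [set: Y] <-> exists h : X -> Y, injective h.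
Proof.
have [[y0]|nY] := pselect (inhabited Y).
  rewrite (card_le_injP _ y0); split=> -[h hi]; exists h => x y; last by move=> _ _ /hi.
  by apply: hi; apply/mem_set.
split=> [/card_leP[f]|[h _]].
  exists (fun x => False_rect Y (nY (inhabits (\val (f (exist _ x (mem_set I))))))) => x.
  by case: (nY _).
apply/card_leP/injfunPex.
by exists (fun x => False_rect _ (nY (inhabits (h (\val x))))) => x; case: (nY _).
Qed.

(** Zorn's lemma gives a maximal graph [G] of a partial injection; were it total on neither side, a
    missing pair [(x0, y0)] could be added. *)
Lemma card_le_total (X Y : Type) :
  [set: X] #<= [set: Y] \/ [set: Y] #<= [set: X].
Proof.
pose P (G : set (X * Y)) := forall u v, G u -> G v -> (u.1 = v.1 <-> u.2 = v.2).
have [G PG Gmax] : exists2 G, P G & forall G', G `<` G' -> ~ P G'.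
  have [|G [PG Gmax]] := @Zorn_bigcup _ P; last by exists G.
  move=> F FP Ftot u v [G FG Gu] [G' FG' Gv].
  have [GG'|G'G] := Ftot _ _ FG FG'; first exact: (FP G' FG' _ _ (GG' _ Gu) Gv).
  exact: (FP G FG _ _ Gu (G'G _ Gv)).
have [tX|/existsNP[x0 /forallNP nx0]] := pselect (forall x, exists y, G (x, y)).
  left; apply/card_leT_injP; have [h hG] := choice tX; exists h => x x' hxx'.
  exact: (PG _ _ (hG x) (hG x')).2.
have [tY|/existsNP[y0 /forallNP ny0]] := pselect (forall y, exists x, G (x, y)).
  right; apply/card_leT_injP; have [h hG] := choice tY; exists h => x x' hxx'.
  exact: (PG _ _ (hG x) (hG x')).1.
case: (Gmax (G `|` [set (x0, y0)])).
  split=> [z Gz|/(_ (x0, y0) (or_intror erefl))/nx0 //]; by left.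
move=> u v [Gu|->] [Gv|->] //=; first exact: PG.
- case: u Gu => a b Gu /=; split=> e; first by subst a; case: (nx0 b).
  by subst b; case: (ny0 a).
- case: v Gv => a b Gv /=; split=> e; first by subst a; case: (nx0 b).
  by subst b; case: (ny0 a).
Qed.

(** The approximations to which Zorn's lemma is applied. [S] will be a copy of [nat], which keeps
    the domain infinite; [sq_fun] is total, but only its values on [sq_dom] count. *)
Record square_injection (X : Type) (S : set X) : Type := SquareInjection {
  sq_dom : set X ;
  sq_fun : X -> X -> X ;
  sq_sub : S `<=` sq_dom ;
  sq_stable : forall a b, sq_dom a -> sq_dom b -> sq_dom (sq_fun a b) ;
  sq_inj : forall a b a' b', sq_dom a -> sq_dom b -> sq_dom a' -> sq_dom b' ->
    sq_fun a b = sq_fun a' b' -> a = a' /\ b = b'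
}.

Definition sq_le (X : Type) (S : set X) (s t : square_injection S) : Prop :=
  sq_dom s `<=` sq_dom t /\
  forall a b, sq_dom s a -> sq_dom s b -> sq_fun s a b = sq_fun t a b.

Lemma nat_square_injection (X : Type) (i : nat -> X) :
  injective i -> inhabited (square_injection (range i)).
Proof.
move=> ii.
have /card_leT_injP[c ci] : [set: nat * nat] #<= [set: nat].
  by have := card_nat2; rewrite card_eq_le => /andP[].
have ki : forall x, exists k, range i x -> i k = x.
  by move=> x; have [[k _ <-]|] := pselect (range i x); [exists k | exists 0].
have [k kP] := choice ki.
apply: (inhabits (@SquareInjection _ _ (range i) (fun a b => i (c (k a, k b))) _ _ _)) => //.
move=> a b a' b' ra rb ra' rb' /ii/ci[ka kb].
by rewrite -(kP a ra) -(kP b rb) ka kb !kP.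
Qed.

Lemma sq_chain (X : Type) (S : set X) (t0 : square_injection S)
    (F : set (square_injection S)) :
  total_on F (@sq_le X S) -> exists t, forall s, F s -> sq_le s t.
Proof.
move=> Ftot.
have [[s0 Fs0]|F0] := pselect (exists s, F s); last first.
  by exists t0 => s Fs; case: F0; exists s.
pose D := \bigcup_(s in F) sq_dom s.
have hF : forall ab, exists s, D ab.1 -> D ab.2 ->
    [/\ F s, sq_dom s ab.1 & sq_dom s ab.2].
  move=> [a b] /=; have [[s Fs sa]|] := pselect (D a); last by exists s0.
  have [[s' Fs' sb]|] := pselect (D b); last by exists s0.
  have [[ss' _]|[s's _]] := Ftot _ _ Fs Fs'; first by exists s'; split=> //; apply: ss'.
  by exists s; split=> //; apply: s's.
have [m mP] := choice hF.
pose g a b := sq_fun (m (a, b)) a b.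
have gE s a b : F s -> sq_dom s a -> sq_dom s b -> g a b = sq_fun s a b.
  move=> Fs sa sb; have [] := mP (a, b); [by exists s|by exists s|] => /= Fm ma mb.
  by have [[_ e]|[_ e]] := Ftot _ _ Fs Fm; rewrite /g e.
(* Injectivity involves four points, which must lie in one member of the chain. *)
have common a b c d : D a -> D b -> D c -> D d ->
    exists2 s, F s & [/\ sq_dom s a, sq_dom s b, sq_dom s c & sq_dom s d].
  move=> Da Db Dc Dd.
  have [F1 a1 b1] := mP (a, b) Da Db; have [F2 c2 d2] := mP (c, d) Dc Dd.
  have [[h _]|[h _]] := Ftot _ _ F1 F2.
    by exists (m (c, d)) => //; split=> //; apply: h.
  by exists (m (a, b)) => //; split=> //; apply: h.
unshelve eexists.
  apply: (@SquareInjection _ _ D g).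
  - by move=> x Sx; exists s0 => //; apply: sq_sub.
  - move=> a b Da Db; have [s Fs [sa sb _ _]] := common _ _ _ _ Da Db Da Db.
    by exists s => //; rewrite (gE s) //; apply: sq_stable.
  - move=> a b a' b' Da Db Da' Db'.
    have [s Fs [sa sb sa' sb']] := common _ _ _ _ Da Db Da' Db'.
    by rewrite !(gE s) //; apply: sq_inj.
move=> s Fs; split=> [x sx|a b sa sb /=]; first by exists s.
by rewrite (gE s).
Qed.

(** Hessenberg's theorem. Let [Y] be the domain of a maximal square injection: either [X] embeds in
    [Y], which suffices, or the complement of [Y] has room for a copy of [Y] and the injection
    extends, against maximality. *)
Lemma card_le_square (X : Type) :
  [set: nat] #<= [set: X] -> [set: X * X] #<= [set: X].
Proof.
move=> /card_leT_injP[i ii].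
have [t0] := nat_square_injection ii.
have [t tmax] : exists t : square_injection (range i),
    forall s, sq_le t s -> sq_le s t.
  have [|||t tmax] := @ZL_preorder _ t0 (fun s t => `[< sq_le s t >]).
  - by move=> s; apply/asboolP; split.
  - move=> s r u /asboolP[rs rsf] /asboolP[su suf]; apply/asboolP.
    split=> [x /rs/su//|a b ra rb]; rewrite rsf ?suf //; exact: rs.
  - move=> F Ftot; have [|t tP] := sq_chain t0 (F := F).
      by move=> s r Fs Fr; have [/asboolP ?|/asboolP ?] := Ftot _ _ Fs Fr; [left|right].
    by exists t => s Fs; apply/asboolP; apply: tP.
  by exists t => s /asboolP/tmax/asboolP.
pose Y := sq_dom t; pose f := sq_fun t.
have fY a b : Y a -> Y b -> Y (f a b) by apply: sq_stable.
have fi a b a' b' : Y a -> Y b -> Y a' -> Y b' -> f a b = f a' b' -> a = a' /\ b = b'.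
  exact: sq_inj.
have Yi k : Y (i k) by apply: (@sq_sub _ _ t); exists k.
have [YX|XY] := card_le_total Y (~` Y); last first.
  (* The complement of Y embeds in Y, so X does too. *)
  have [h hi] : exists h : X -> X, [/\ injective h & forall x, Y (h x)].
    move/card_leT_injP: XY => [g gi].
    exists (fun x => if pselect (Y x) is right nYx
              then f (i 1) (\val (g (exist _ x (mem_set nYx)))) else f (i 0) x).
    split=> [x y|x]; last first.
      by case: pselect => nx; apply: fY => //; apply: set_valP.
    case: pselect => nx; case: pselect => ny e.
    - by have [] := fi _ _ _ _ (Yi 0) nx (Yi 0) ny e.
    - by have [/ii] := fi _ _ _ _ (Yi 0) nx (Yi 1) (set_valP _) e.
    - by have [/ii] := fi _ _ _ _ (Yi 1) (set_valP _) (Yi 0) ny e.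
    - by have [_ /val_inj/gi[]] := fi _ _ _ _ (Yi 1) (set_valP _) (Yi 1) (set_valP _) e.
  case: hi => hi hY.
  apply/card_leT_injP; exists (fun ab => f (h ab.1) (h ab.2)) => -[a b] [a' b'] /= e.
  by have [/hi -> /hi ->] := fi _ _ _ _ (hY _) (hY _) (hY _) (hY _) e.
(* Otherwise a disjoint copy h @` Y of Y allows a proper extension. *)
have [h hn hinj] : exists2 h : X -> X, (forall y, Y y -> ~ Y (h y)) &
    forall x y, Y x -> Y y -> h x = h y -> x = y.
  move/card_leT_injP: YX => [g gi].
  exists (fun x => if pselect (Y x) is left Yx
            then \val (g (exist _ x (mem_set Yx))) else x).
    move=> y Yy; case: pselect => // Yy'; exact: set_valP (g _).
  move=> x y Yx Yy; case: pselect => // Yx'; case: pselect => // Yy'.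
  by move=> /val_inj/gi[].
have /choice[q qP] : forall x, exists qx, (Y `|` h @` Y) x ->
    Y qx /\ ((Y x /\ qx = x) \/ (~ Y x /\ h qx = x)).
  move=> x; have [Yx|nYx] := pselect (Y x).
    by exists x => _; split=> //; left.
  have [[y Yy <-]|nh] := pselect ((h @` Y) x); last by exists x => -[].
  by exists y => _; split=> //; right; split=> //; apply: hn.
have qY x : (Y `|` h @` Y) x -> Y (q x) by move=> /qP[].
(* [q] folds the copy back onto [Y]; the tag records which of [a] and [b] lie in [Y], so that
   [tag a b], [q a] and [q b] together determine [a] and [b]. *)
pose tag a b := i (if `[< Y a >] then if `[< Y b >] then 3 else 0
                   else if `[< Y b >] then 1 else 2).
have Ytag a b : Y (tag a b) by apply: Yi.
pose g a b := if `[< Y a /\ Y b >] then f a b else h (f (tag a b) (f (q a) (q b))).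
have gE a b : Y a -> Y b -> g a b = f a b.
  by move=> Ya Yb; rewrite /g; case: asboolP => // -[].
have gN a b : (Y `|` h @` Y) a -> (Y `|` h @` Y) b -> ~ (Y a /\ Y b) ->
    g a b = h (f (tag a b) (f (q a) (q b))) by move=> _ _ nab; rewrite /g; case: asboolP.
pose Z := Y `|` h @` Y.
have gZ a b : Z a -> Z b -> Z (g a b).
  move=> Ya Yb; have [[aY bY]|nab] := pselect (Y a /\ Y b).
    by rewrite gE //; left; apply: fY.
  rewrite gN //; right; exists (f (tag a b) (f (q a) (q b))) => //.
  by apply: (fY) => //; apply: fY; apply: qY.
have ginj a b a' b' : Z a -> Z b -> Z a' -> Z b' -> g a b = g a' b' -> a = a' /\ b = b'.
  (* Pairs from [Y] take their values in [Y], all others in the disjoint copy. *)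
  have sep u v u' v' : Y u -> Y v -> Z u' -> Z v' ->
      ~ (Y u' /\ Y v') -> g u v <> g u' v'.
    move=> Ya Yb Yu' Yv' nav'; rewrite gE // gN // => e.
    apply: (hn (f (tag u' v') (f (q u') (q v')))); last by rewrite -e; apply: fY.
    by apply: (fY) => //; apply: fY; apply: qY.
  move=> Ya Yb Ya' Yb'.
  have [[aY bY]|nab] := pselect (Y a /\ Y b);
    have [[aY' bY']|nab'] := pselect (Y a' /\ Y b').
  + by rewrite !gE //; apply: fi.
  + by move/(sep _ _ _ _ aY bY Ya' Yb' nab').
  + by move/esym/(sep _ _ _ _ aY' bY' Ya Yb nab).
  rewrite !gN //.
  move/hinj => /(_ (fY _ _ (Ytag _ _) (fY _ _ (qY _ Ya) (qY _ Yb)))).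
  move=> /(_ (fY _ _ (Ytag _ _) (fY _ _ (qY _ Ya') (qY _ Yb')))).
  move/fi => /(_ (Ytag _ _) (fY _ _ (qY _ Ya) (qY _ Yb))).
  move=> /(_ (Ytag _ _) (fY _ _ (qY _ Ya') (qY _ Yb'))) [/ii tagE].
  move/fi => /(_ (qY _ Ya) (qY _ Yb) (qY _ Ya') (qY _ Yb')) [qa qb].
  have [YE YE'] : (Y a <-> Y a') /\ (Y b <-> Y b').
    by move: tagE; do 4![case: asboolP => ?].
  have inq x x' : (Y `|` h @` Y) x -> (Y `|` h @` Y) x' -> (Y x <-> Y x') ->
      q x = q x' -> x = x'.
    move=> /qP[_ Hx] /qP[_ Hx'] e qq.
    case: Hx Hx' => -[Yx ex] [] [Yx' ex']; try by rewrite -ex qq ex'.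
      by case: Yx'; apply/e.
    by case: Yx; apply/e.
  by split; apply: inq.
have SZ : range i `<=` Z by move=> x [k _ <-]; left; apply: Yi.
have [] := tmax (SquareInjection SZ gZ ginj).
  by split=> [x|a b Ya Yb /=]; [left | rewrite gE].
move=> sub _; exfalso; apply: (hn (i 0) (Yi 0)); apply: sub; right.
by exists (i 0).
Qed.

(** Iterate the pairing; the length is stored because the folded code need not tell where the
    sequence ends. *)
Lemma card_le_seq (X : Type) :
  [set: nat] #<= [set: X] -> [set: seq X] #<= [set: X].
Proof.
move=> natX; move/card_le_square/card_leT_injP: (natX) => [f fi].
move/card_leT_injP: natX => [i ii].
pose code := foldr (fun x y => f (x, y)) (i 0).
apply/card_leT_injP; exists (fun s => f (i (size s), code s)).
move=> s s' /fi[/ii]; elim: s s' => [|x s IH] [|x' s'] //= [sz].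
by move=> /fi[-> e]; rewrite (IH s').
Qed.

Lemma card_bigcup_le (I T X : Type) (F : I -> set T) :
  [set: nat] #<= [set: X] -> [set: I] #<= [set: X] ->
  (forall i, F i #<= [set: X]) -> \bigcup_i F i #<= [set: X].
Proof.
move=> natX; move/card_le_square: (natX) => XX /card_leT_injP[j ji] FX.
move/card_leT_injP: (natX) => [k _].
have /choice[h hi] : forall i, exists h : T -> X, set_inj (F i) h.
  by move=> i; apply/(card_le_injP _ (k 0)).
have [[i0]|nI] := pselect (inhabited I); last first.
  by rewrite (_ : \bigcup_i F i = set0) ?card_ge0 //; apply/seteqP; split=> // x [i]; case: nI.
have /choice[w wP] : forall x, exists i, (\bigcup_i F i) x -> F i x.
  by move=> x; have [[i _ Fx]|] := pselect ((\bigcup_i F i) x); [exists i|exists i0].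
apply: card_le_trans XX; apply/(card_le_injP _ (k 0, k 0)).
exists (fun x => (j (w x), h (w x) x)) => x y /set_mem/wP Fx /set_mem/wP Fy [/ji wE].
by rewrite -wE in Fy *; apply: hi; apply: mem_set.
Qed.

Lemma card_le_lt_trans (T U V : Type) (A : set T) (B : set U) (D : set V) :
  A #<= B -> card_lt B D -> card_lt A D.
Proof.
move=> AB [BD nDB]; split; first exact: card_le_trans AB BD.
by move=> DA; apply: nDB; apply: card_le_trans DA AB.
Qed.

Lemma card_eqW (T U : Type) (A : set T) (B : set U) : A #= B -> A #<= B /\ B #<= A.
Proof. by rewrite card_eq_le => /andP. Qed.

Lemma card_le_prod (X Y X' Y' : Type) :
  [set: X] #<= [set: X'] -> [set: Y] #<= [set: Y'] -> [set: X * Y] #<= [set: X' * Y'].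
Proof.
move=> /card_leT_injP[f fi] /card_leT_injP[g gi]; apply/card_leT_injP.
by exists (fun xy => (f xy.1, g xy.2)) => -[x y] [x' y'] [/fi -> /gi ->].
Qed.

Lemma card_setU_le (T X : Type) (A B : set T) : [set: nat] #<= [set: X] ->
  A #<= [set: X] -> B #<= [set: X] -> A `|` B #<= [set: X].
Proof.
move=> natX AX BX.
rewrite (_ : A `|` B = \bigcup_(b : bool) (if b then A else B)).
  apply: card_bigcup_le => //; last by case.
  by apply: card_le_trans natX; apply: countableP.
by apply/seteqP; split=> x [] => [Ax|Bx|[] _ h]; [exists true|exists false|left|right].
Qed.

(** By comparability the larger of the two serves as [W]; later unions are bounded inside such a
    [W]. *)
Lemma card_lt_sup (X Y Z : Type) :
  card_lt [set: X] [set: Z] -> card_lt [set: Y] [set: Z] ->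
  exists W : Type, [/\ [set: X] #<= [set: W], [set: Y] #<= [set: W] &
    card_lt [set: W] [set: Z]].
Proof.
move=> XZ YZ; have [XY|YX] := card_le_total X Y.
  by exists Y; split=> //; apply: card_lexx.
by exists X; split=> //; apply: card_lexx.
Qed.

(** * Formulas, definable sets and saturation *)

Definition sumv (U V M : Type) (a : U -> M) (c : V -> M) (x : U + V) : M :=
  match x with inl i => a i | inr j => c j end.

Lemma sumv_comp (U V M M' : Type) (f : M -> M') (a : U -> M) (c : V -> M) :
  f \o sumv a c = sumv (f \o a) (f \o c).
Proof. by apply/funext => -[]. Qed.

(** Proof irrelevance replaces decidable equality, which the types of symbols need not have. *)
Lemma existT_inj (A : Type) (P : A -> Type) x (p q : P x) :
  existT P x p = existT P x q -> p = q.
Proof.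
by move=> e; have := projT2_eq e; rewrite (Prop_irrelevance (projT1_eq e) erefl).
Qed.

Lemma I0_false (i : 'I_0) : False.
Proof. by case: i. Qed.

Section Syntax.
Variable L : language.

Lemma eval_rename (M : structure L) (V W : Type) (g : V -> W) (v : W -> M)
    (t : term L V) : eval v (term_rename g t) = eval (v \o g) t.
Proof. by elim: t => //= f u IH; congr fint; apply/funext. Qed.

Lemma sat_rename (M : structure L) (V W : Type) (g : V -> W) (v : W -> M)
    (phi : formula L V) : sat (rename g phi) v <-> sat phi (v \o g).
Proof.
elim: phi W g v => {V} [V|V s t|V r t|V phi IH psi IH'|V phi IH] W g v //=.
- by rewrite !eval_rename.
- by under eq_fun do rewrite eval_rename.
- by rewrite IH IH'.
- have e x : extend v x \o omap g = extend (v \o g) x by apply/funext => -[].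
  by split=> + x => /(_ x); rewrite IH e.
Qed.

Lemma psat_inst (M : structure L) n m (phi : formula L ('I_n + 'I_m))
    (c : 'I_m -> M) (a : 'I_n -> M) : psat (inst phi c) a <-> sat phi (sumv a c).
Proof.
rewrite /psat /inst sat_rename; set v := _ \o _.
by rewrite (_ : v = sumv a c) //; apply/funext => -[].
Qed.

Lemma sat_Not (M : structure L) V (phi : formula L V) (v : V -> M) :
  sat (Not phi) v <-> ~ sat phi v.
Proof. by []. Qed.

Definition And (V : Type) (phi psi : formula L V) := Not (Imp phi (Not psi)).

Lemma sat_And (M : structure L) V (phi psi : formula L V) (v : V -> M) :
  sat (And phi psi) v <-> sat phi v /\ sat psi v.
Proof.
rewrite /=; split=> [h|[h1 h2] /(_ h1)/(_ h2)//].
by split; apply: contrapT => h'; apply: h => // h1; case: (h' h1).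
Qed.

Lemma term_rename_inj (V W : Type) (g : V -> W) :
  injective g -> injective (@term_rename L V W g).
Proof.
move=> gi; elim=> [x|f u IH] [y|f' u'] //=; first by case=> /gi ->.
case=> ff; subst f' => h; have uu := existT_inj h; congr App; apply/funext => i.
by apply: IH; exact: (congr1 (fun h => h i) uu).
Qed.

Lemma rename_inj (V W : Type) (g : V -> W) :
  injective g -> injective (@rename L V W g).
Proof.
move=> gi phi; elim: phi W g gi => {V} [V|V s t|V r t|V phi IH psi IH'|V phi IH]
  W g gi [|s' t'|r' t'|phi' psi'|phi'] //=.
- by case=> /(term_rename_inj gi) -> /(term_rename_inj gi) ->.
- case=> ff; subst r' => h; have uu := existT_inj h; congr Rel; apply/funext => i.
  by apply: (term_rename_inj gi); exact: (congr1 (fun h => h i) uu).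
- by case=> /(IH _ _ gi) -> /(IH' _ _ gi) ->.
- case=> /IH -> //; by move=> [x|] [y|] //= [/gi ->].
Qed.

(** Quantifiers bind one variable at a time: [g] turns the variable [ord0] into the bound one and
    the induction treats the rest, so [V] must vary. *)
Lemma All_block n V (phi : formula L ('I_n + V)) :
  exists psi : formula L V, forall (M : structure L) (v : V -> M),
    sat psi v <-> forall a : 'I_n -> M, sat phi (sumv a v).
Proof.
elim: n V phi => [|n IH] V phi.
  pose g (x : 'I_0 + V) := match x with
    | inl i => False_rect V (I0_false i)
    | inr v => v end.
  exists (rename g phi) => M v; rewrite sat_rename.
  have e a : v \o g = sumv a v by apply/funext => -[[]|].
  split=> [h a|/(_ (fun i : 'I_0 => v (g (inl i))))]; first by rewrite -e.
  by rewrite -e.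
pose g (x : 'I_n.+1 + V) : 'I_n + option V := match x with
  | inl i => if unlift ord0 i is Some j then inl j else inr None
  | inr v => inr (Some v) end.
have [psi psiP] := IH _ (rename g phi).
exists (All psi) => M v /=; split=> [h a|h x].
  have /psiP/(_ (fun j => a (lift ord0 j)))/sat_rename := h (a ord0).
  rewrite (_ : _ \o g = sumv a v) //; apply/funext => -[i|//] /=.
  by case: unliftP => [j|] ->.
apply/psiP => a; apply/sat_rename.
rewrite (_ : _ \o g = sumv (fun i => if unlift ord0 i is Some j then a j else x) v) //.
by apply/funext => -[i|//] /=; case: unliftP.
Qed.

Lemma Ex_block n V (phi : formula L ('I_n + V)) :
  exists psi : formula L V, forall (M : structure L) (v : V -> M),
    sat psi v <-> exists a : 'I_n -> M, sat phi (sumv a v).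
Proof.
have [psi psiP] := All_block (Not phi).
exists (Not psi) => M v; rewrite sat_Not psiP; split=> [/existsNP[a /contrapT h]|[a h] /(_ a)/=].
  by exists a.
exact.
Qed.

End Syntax.

Lemma nat_le_formulas (L : language) : [set: nat] #<= [set: formula L nat].
Proof. by apply/card_leT_injP; exists (fun i => Eq (Var i) (Var i)) => i j []. Qed.

(** The variables are numbered consecutively. A formula need not mention all its variables, so [m]
    is stored in an equation put in front. *)
Lemma card_formulas_split (L : language) n :
  [set: {m & formula L ('I_n + 'I_m)}] #<= [set: formula L nat].
Proof.
pose g m (x : 'I_n + 'I_m) : nat := match x with inl i => val i | inr j => n + val j end.
have gi m : injective (@g m).
  move=> [i|j] [i'|j'] /=.
  - by move/val_inj ->.
  - by move=> e; have := ltn_ord i; rewrite e ltnNge leq_addr.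
  - by move=> e; have := ltn_ord i'; rewrite -e ltnNge leq_addr.
  - by move/addnI/val_inj ->.
apply/card_leT_injP.
exists (fun mf => Imp (Eq (Var (projT1 mf)) (Var (projT1 mf))) (rename (@g _) (projT2 mf))).
move=> [m phi] [m' phi'] /= [mm' _]; subst m'.
by move=> /(rename_inj (gi m)) ->.
Qed.

Section Definable.
Variables (L : language) (C : structure L).

(* Indexing parameters by a finite type rather than by 'I_m makes amalgamating
   parameter tuples immediate. *)
Definition definable_over n (B : set C) (D : set ('I_n -> C)) : Prop :=
  exists (F : finType) (phi : formula L ('I_n + F)) (c : F -> C),
    (forall j, B (c j)) /\ forall a, D a <-> sat phi (sumv a c).

Lemma definable_overP n (B : set C) (D : set ('I_n -> C)) :
  definable_over B D <->
  exists2 theta : pformula C n, pformulas_over B theta & forall a, D a <-> psat theta a.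
Proof.
split=> [[F [phi [c [Bc DP]]]]|[_ [m [phi [c [Bc ->]]]] DP]]; last first.
  by exists 'I_m, phi, c; split=> // a; rewrite DP psat_inst.
pose g (x : 'I_n + F) : 'I_n + 'I_#|F| := match x with
  | inl i => inl i | inr j => inr (enum_rank j) end.
exists (inst (rename g phi) (c \o enum_val)).
  by exists #|F|, (rename g phi), (c \o enum_val); split=> //= j; apply: Bc.
move=> a; rewrite DP psat_inst sat_rename.
rewrite (_ : _ \o g = sumv a c) //; apply/funext => -[i|j] //=.
by rewrite enum_rankK.
Qed.

Lemma definable_inst n m (B : set C) (phi : formula L ('I_n + 'I_m)) (c : 'I_m -> C) :
  (forall j, B (c j)) -> definable_over B [set a | sat phi (sumv a c)].
Proof. by move=> Bc; exists 'I_m, phi, c; split. Qed.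

Lemma definableC n (B : set C) (D : set ('I_n -> C)) :
  definable_over B D -> definable_over B (~` D).
Proof.
move=> [F [phi [c [Bc DP]]]]; exists F, (Not phi), c; split=> // a.
by rewrite sat_Not -DP.
Qed.

Lemma definableI n (B : set C) (D D' : set ('I_n -> C)) :
  definable_over B D -> definable_over B D' -> definable_over B (D `&` D').
Proof.
move=> [F [phi [c [Bc DP]]]] [F' [phi' [c' [Bc' DP']]]].
pose g (x : 'I_n + F) : 'I_n + (F + F') :=
  match x with inl i => inl i | inr j => inr (inl j) end.
pose g' (x : 'I_n + F') : 'I_n + (F + F') :=
  match x with inl i => inl i | inr j => inr (inr j) end.
exists (F + F')%type, (And (rename g phi) (rename g' phi')), (sumv c c').
split=> [[]//|a]; rewrite sat_And !sat_rename /setI /= DP DP'.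
rewrite (_ : sumv _ _ \o g = sumv a c); last by apply/funext => -[].
by rewrite (_ : sumv _ _ \o g' = sumv a c') //; apply/funext => -[].
Qed.

Lemma definableD n (B : set C) (D D' : set ('I_n -> C)) :
  definable_over B D -> definable_over B D' -> definable_over B (D `\` D').
Proof. by move=> hD hD'; rewrite setDE; apply: definableI => //; apply: definableC. Qed.

Lemma definableT n (B : set C) : definable_over B (@setT ('I_n -> C)).
Proof.
exists 'I_0, (Imp Bot Bot), (fun i => False_rect _ (I0_false i)).
by split=> [[]//|a] /=.
Qed.

Lemma definable_sub n (B B' : set C) (D : set ('I_n -> C)) :
  B `<=` B' -> definable_over B D -> definable_over B' D.
Proof. by move=> BB' [F [phi [c [Bc DP]]]]; exists F, phi, c; split=> // j; apply: BB'. Qed.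

End Definable.

Lemma finite_set_In (T : Type) (G : set T) :
  finite_set G -> exists s : seq T, forall x, G x <-> List.In x s.
Proof.
move=> fG; have /finite_seqP[s sE] : finite_set (G : set {classic T}) by [].
exists s => x; rewrite sE /=; elim: s {sE} => //= y s IH.
by rewrite in_cons; split=> [/orP[/eqP->|/IH]|[->|/IH ->]]; [left|right|rewrite eqxx|rewrite orbT].
Qed.

Lemma finite_In (T : Type) (s : seq T) : finite_set [set x | List.In x s].
Proof.
elim: s => [|x s IH]; first by rewrite (_ : [set _ | _] = set0) //; apply/seteqP; split.
rewrite (_ : [set _ | _] = [set x] `|` [set x | List.In x s]).
  by rewrite finite_setU; split.
by apply/seteqP; split=> y /= [->|]; [left|right|left|right].
Qed.

Section Saturation.
Variables (L : language) (C : structure L) (kbar : cardinal).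
Hypothesis Csat : saturated C kbar.

(** Saturation speaks of complete types only, so the filter generated by the [D i] is extended to an
    ultrafilter [U]; the formulas over [E] whose solution sets lie in [U] form a complete type,
    whose realizations lie in every [D i]. *)
Lemma saturated_realize n (E : set C) (D : nat -> set ('I_n -> C)) :
  small kbar E -> (forall i, definable_over E (D i)) ->
  (forall k, exists a, forall i, i < k -> D i a) -> exists a, forall i, D i a.
Proof.
move=> Esm /(_ _)/definable_overP Ddef Dfip.
have [theta thetaE thetaP] : exists2 theta : nat -> pformula C n,
    forall i, pformulas_over E (theta i) & forall i a, D i a <-> psat (theta i) a.
  have /choice[th thP] : forall i, exists th, pformulas_over E th /\
      forall a, D i a <-> psat th a by move=> i; have [th] := Ddef i; exists th.
  by exists th => i; case: (thP i).
pose F : set_system ('I_n -> C) := [set X | exists k, [set a | forall i, i < k -> D i a] `<=` X].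
have FF : ProperFilter F.
  apply: Build_ProperFilter_ex.
    by move=> X [k DX]; have [a /DX] := Dfip k; exists a.
  split.
  - by exists 0.
  - move=> X Y [k DX] [l DY]; exists (maxn k l) => a Da; split.
      by apply: DX => i ik; apply: Da; rewrite leq_max ik.
    by apply: DY => i il; apply: Da; rewrite leq_max il orbT.
  - by move=> X Y XY [k DX]; exists k => a /DX/XY.
have [U [UU FU]] := ultraFilterLemma FF.
have UF : Filter U := @filter_filter _ _ (@ultra_proper _ _ UU).
pose q := [set th | pformulas_over E th /\ U [set a | psat th a]].
have qc : complete_type E q.
  split.
  - by move=> th [].
  - move=> G /finite_set_In[s sP] Gq.
    have : U [set a | forall th, List.In th s -> psat th a].
      have {Gq} : forall th, List.In th s -> U [set a | psat th a] by move=> th /sP/Gq[].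
      elim: s {sP} => [|th s IH] hs.
        by apply: (@filterS _ U UF _ _ _ (@filterT _ U UF)) => a _ th [].
      have h := @filterI _ U UF _ _ (hs th (or_introl erefl))
        (IH (fun th' h => hs th' (or_intror h))).
      by apply: (@filterS _ U UF _ _ _ h) => a [ha hs'] th' [<-//|/hs'].
    by move=> /(@filter_ex _ U (@ultra_proper _ _ UU))[a ha]; exists a => th /sP/ha.
  - move=> th [m [phi [c [Ec ->]]]].
    have [h|h] := in_ultra_setVsetC [set a | psat (inst phi c) a] UU.
      by left; split=> //; exists m, phi, c.
    by right; split=> //; exists m, (Not phi), c.
have [a aq] := Csat Esm qc.
exists a => i; apply/thetaP/aq; split=> //; apply: FU.
by exists i.+1 => b /(_ i (ltnSn i))/thetaP.
Qed.

End Saturation.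

(** * Shattering and the independence property *)

Section Shatter.
Variables (L : language) (C : structure L) (n m : nat).
Variable phi : formula L ('I_n + 'I_m).

Definition solutions (c : 'I_m -> C) : set ('I_n -> C) := [set a | sat phi (sumv a c)].

(* Every sign pattern on the instances phi(x, c), c in cs, is realized in D. *)
Fixpoint shatters (cs : seq ('I_m -> C)) (D : set ('I_n -> C)) : Prop :=
  match cs with
  | [::] => D !=set0
  | c :: cs => shatters cs (D `&` solutions c) /\ shatters cs (D `\` solutions c)
  end.

Lemma shatters_neq0 cs D : shatters cs D -> D !=set0.
Proof. by elim: cs D => //= c cs IH D [/IH[a [Da _]] _]; exists a. Qed.

Lemma shatters_catl s t D : shatters (s ++ t) D -> shatters s D.
Proof.
elim: s D => [|c s IH] D /=; first exact: shatters_neq0.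
by case=> /IH ? /IH.
Qed.

Lemma shatters_pattern c0 cs D (S : set nat) : shatters cs D ->
  exists a, D a /\ forall i, i < size cs -> solutions (nth c0 cs i) a <-> S i.
Proof.
elim: cs D S => [|c cs IH] D S /=; first by case=> a; exists a.
move=> [pos neg].
have [S0|nS0] := pselect (S 0).
  have [a [[Da ca] aP]] := IH _ [set i | S i.+1] pos.
  by exists a; split=> // -[|i]; [rewrite /=; split | apply: aP].
have [a [[Da ca] aP]] := IH _ [set i | S i.+1] neg.
by exists a; split=> // -[|i]; [rewrite /=; split | apply: aP].
Qed.

Definition at_vars V (y : 'I_m -> V) : formula L ('I_n + V) :=
  rename (fun x => match x with inl i => inl i | inr j => inr (y j) end) phi.

Lemma sat_at_vars V (y : 'I_m -> V) (v : V -> C) a :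
  sat (at_vars y) (sumv a v) <-> solutions (v \o y) a.
Proof.
rewrite /at_vars sat_rename /solutions /=; set w := _ \o _.
by rewrite (_ : w = sumv a (v \o y)) //; apply/funext => -[].
Qed.

(** A list [ds] is needed because each splitting doubles the sets while the same tuples must shatter
    both halves. [N] is lowered by turning a new tuple into quantified variables; once [N] is 0,
    [ys] is consumed by splitting. *)
Lemma shatters_definable N V (ys : seq ('I_m -> V)) (ds : seq (formula L ('I_n + V))) :
  exists chi : formula L V, forall v : V -> C, sat chi v <->
    exists2 cs, size cs = N & List.Forall (fun d =>
      shatters ([seq v \o y | y <- ys] ++ cs) [set a | sat d (sumv a v)]) ds.
Proof.
elim: N V ys ds => [|N IH] V ys ds.
  elim: ys ds => [|y ys IHys] ds.
    elim: ds => [|d ds [chi chiP]].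
      by exists (Imp Bot Bot) => v; split=> //= _; exists [::].
    have [psi psiP] := Ex_block d.
    exists (And psi chi) => v; rewrite sat_And psiP chiP; split.
      by move=> [ne [cs /size0nil->] h]; exists [::] => //; constructor.
    move=> [cs /size0nil-> h]; inversion_clear h.
    by split=> //; exists [::].
  have [chi chiP] := IHys (flatten
    [seq [:: And d (at_vars y); And d (Not (at_vars y))] | d <- ds]).
  exists chi => v; rewrite chiP.
  have E cs : List.Forall (fun d =>
      shatters ([seq v \o y | y <- ys] ++ cs) [set a | sat d (sumv a v)])
      (flatten [seq [:: And d (at_vars y); And d (Not (at_vars y))] | d <- ds]) <->
    List.Forall (fun d =>
      shatters ([seq v \o y | y <- y :: ys] ++ cs) [set a | sat d (sumv a v)]) ds.
    elim: ds {chiP} => [|d ds IHds] /=; first by split=> _; constructor.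
    rewrite !List.Forall_cons_iff IHds /=.
    rewrite (_ : [set a | sat (And d (at_vars y)) _] =
        [set a | sat d (sumv a v)] `&` solutions (v \o y)); last first.
      apply/funext => a; apply/propext; apply: iff_trans (sat_And _ _ _) _.
      by rewrite sat_at_vars.
    rewrite (_ : [set a | sat (And d (Not (at_vars y))) _] =
        [set a | sat d (sumv a v)] `\` solutions (v \o y)); last first.
      apply/funext => a; apply/propext; apply: iff_trans (sat_And _ _ _) _.
      by rewrite sat_Not sat_at_vars.
    by split=> [[? []]|[[? ?] ?]].
  by split=> -[cs sz /E h]; exists cs.
pose lift (x : 'I_n + V) : 'I_n + ('I_m + V) :=
  match x with inl i => inl i | inr w => inr (inr w) end.
have [chi chiP] := IH ('I_m + V)%type
  (rcons [seq inr \o y | y <- ys] inl) [seq rename lift d | d <- ds].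
have [psi psiP] := Ex_block chi.
exists psi => v; rewrite psiP.
have E c cs : List.Forall (fun d => shatters
      ([seq sumv c v \o y | y <- rcons [seq inr \o y | y <- ys] inl] ++ cs)
      [set a | sat d (sumv a (sumv c v))]) [seq rename lift d | d <- ds] <->
    List.Forall (fun d =>
      shatters ([seq v \o y | y <- ys] ++ c :: cs) [set a | sat d (sumv a v)]) ds.
  rewrite List.Forall_map map_rcons cat_rcons -map_comp.
  rewrite !List.Forall_forall; split=> h d /h.
    set D := [set a | _]; rewrite (_ : D = [set a | sat d (sumv a v)]) //.
    apply/funext => a; apply/propext; rewrite /D /= sat_rename.
    by rewrite (_ : _ \o lift = sumv a v) //; apply/funext => -[].
  set D := [set a | _]; rewrite (_ : D = [set a | sat (rename lift d) (sumv a (sumv c v))]) //.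
  apply/funext => a; apply/propext; rewrite /D /= sat_rename.
  by rewrite (_ : _ \o lift = sumv a v) //; apply/funext => -[].
split=> [[c /chiP[cs sz /E h]]|[[//|c cs] [sz] /E h]].
  by exists (c :: cs); rewrite /= ?sz.
by exists c; apply/chiP; exists cs.
Qed.

(** Unlike plain shattering, this guarantees a next tuple that preserves it. *)
Definition arbitrarily_shattered (s : seq ('I_m -> C)) : Prop :=
  forall N, exists2 cs, size cs = N & shatters (s ++ cs) setT.

Variable kbar : cardinal.
Hypothesis Csat : saturated C kbar.
Hypothesis kbar_uncountable : card_lt [set: nat] [set: kbar].

Lemma countable_small (F : countType) (w : F -> C) : small kbar (range w).
Proof.
apply: card_le_lt_trans kbar_uncountable.
by apply: card_le_trans (card_image_le w setT) _; apply: countableP.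
Qed.

(** Saturation finds one [c] for all [N]: [D N] is definable over the finitely many entries of [s],
    and the first tuple of an extension of length [k.+1] lies in every [D i] with [i < k]. *)
Lemma arbitrarily_shattered_rcons s :
  arbitrarily_shattered s -> exists c, arbitrarily_shattered (rcons s c).
Proof.
move=> sinf; have [x0] := dom_inhabited C.
pose F : finType := ('I_(size s) * 'I_m)%type.
pose w (f : F) : C := nth (fun=> x0) s f.1 f.2.
(* [inr (i, j)] stands for entry [j] of the [i]-th tuple of [s], and [inl] for the new tuple. *)
pose ys : seq ('I_m -> 'I_m + F) :=
  rcons [seq (fun j => inr (i, j)) | i <- enum 'I_(size s)] inl.
pose D N := [set c | exists2 cs, size cs = N & shatters (rcons s c ++ cs) setT].
have ysE c : [seq sumv c w \o y | y <- ys] = rcons s c.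
  rewrite map_rcons -map_comp; congr (rcons _ c).
  transitivity [seq nth (fun=> x0) s i | i <- map val (enum 'I_(size s))].
    by rewrite -map_comp; apply: eq_map => i; apply/funext.
  by rewrite val_enum_ord map_nth_iota0 // take_size.
have Ddef N : definable_over (range w) (D N).
  have [chi chiP] := shatters_definable N ys [:: Imp Bot Bot].
  exists F, chi, w; split=> [f|c]; first by exists f.
  have ET : [set a : 'I_n -> C | sat (Imp (@Bot L ('I_n + ('I_m + F))) Bot)
      (sumv a (sumv c w))] = setT by apply/seteqP; split=> a _ /=.
  rewrite chiP ysE; split=> -[cs sz h]; exists cs => //.
    by apply/List.Forall_cons_iff; rewrite ET.
  by move/List.Forall_cons_iff: h; rewrite ET => -[].
have [k|c cP] := saturated_realize Csat (@countable_small F w) Ddef; last first.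
  by exists c.
have [[|c cs] [sz] h] := sinf k.+1; first by [].
exists c => i ik; exists (take i cs); first by rewrite size_takel // sz ltnW.
apply: (@shatters_catl _ (drop i cs)).
by rewrite -catA cat_take_drop cat_rcons.
Qed.

Lemma shattered_sequence : arbitrarily_shattered [::] ->
  exists c : nat -> 'I_m -> C, forall k, shatters (mkseq c k) setT.
Proof.
move=> inf0; have [x0] := dom_inhabited C.
have /choice[nxt nxtP] : forall s, exists c, arbitrarily_shattered s ->
    arbitrarily_shattered (rcons s c).
  move=> s; have [/arbitrarily_shattered_rcons[c cP]|] := pselect (arbitrarily_shattered s).
    by exists c.
  by exists (fun=> x0).
pose s k := iter k (fun s => rcons s (nxt s)) [::].
pose c k := nxt (s k).
have sE k : mkseq c k = s k.
  by elim: k => //= k IH; rewrite mkseqS IH.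
exists c => k; rewrite sE; have : arbitrarily_shattered (s k).
  by elim: k => //= k IH; apply: nxtP.
by move=> /(_ 0)[cs _]; apply: shatters_catl.
Qed.

(** In [independence_property] the sequence fills the first block of variables; here the sequence
    consists of the shattered parameters, which fill the second. *)
Definition swap_vars : formula L ('I_m + 'I_n) :=
  rename (fun x => match x with inl i => inr i | inr j => inl j end) phi.

(** For each [S], finitely many of the conditions can be met since every sign pattern occurs;
    saturation meets them all. *)
Lemma shattered_independence :
  arbitrarily_shattered [::] -> independence_property C swap_vars.
Proof.
move=> /shattered_sequence[c cP].
pose E := range (fun ij : nat * 'I_m => c ij.1 ij.2).
have cdef i : definable_over E (solutions (c i)).
  by apply: definable_inst => j; exists (i, j).
have /choice[a aP] : forall S : set nat, exists a, forall i, solutions (c i) a <-> S i.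
  move=> S; pose D i := [set a | solutions (c i) a <-> S i].
  apply: (@saturated_realize _ _ _ Csat _ E D).
  - exact: countable_small.
  - move=> i; have [Si|nSi] := pselect (S i).
      by rewrite (_ : D i = solutions (c i)) //; apply/seteqP; split=> a //= [_ h]; apply: h.
    rewrite (_ : D i = ~` solutions (c i)); first exact: definableC.
    by apply/seteqP; split=> a /=; [case=> h _ /h | split].
  - move=> k; have [a [_ aP]] := shatters_pattern (c 0) S (cP k).
    exists a => i ik; have := aP i; rewrite size_mkseq => /(_ ik).
    by rewrite nth_mkseq.
exists c, a => i S; rewrite -aP psat_inst sat_rename /solutions /=.
by rewrite (_ : _ \o _ = sumv (a S) (c i)) //; apply/funext => -[].
Qed.

End Shatter.

(** * Elementary substructures *)

Section LowenheimSkolem.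
Variables (L : language) (C : structure L).

Lemma elementary_map_fin (N M : structure L) (f : N -> M) : elementary_map f ->
  forall (F : finType) (phi : formula L F) (v : F -> N), sat phi v <-> sat phi (f \o v).
Proof.
move=> felem F phi v; have := felem _ (rename enum_rank phi) (v \o enum_val).
rewrite !sat_rename (_ : (v \o enum_val) \o enum_rank = v); last first.
  by apply/funext => x /=; rewrite enum_rankK.
rewrite (_ : (f \o (v \o enum_val)) \o enum_rank = f \o v) //.
by apply/funext => x /=; rewrite enum_rankK.
Qed.

(** The condition of the Tarski-Vaught test. *)
Definition witness_closed (N : set C) : Prop :=
  forall k (phi : formula L (option 'I_k)) (c : 'I_k -> C), (forall j, N (c j)) ->
    (exists x, sat phi (extend c x)) -> exists2 x, N x & sat phi (extend c x).

Lemma model_witness_closed (M : substructure C) : is_model M -> witness_closed M.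
Proof.
move=> Mmod k phi c Mc [x xP].
pose v j : induced M := exist _ (c j) (mem_set (Mc j)).
have /existsNP[y /contrapT yP] : ~ forall y, ~ sat phi (extend v y).
  apply: (Mmod _ (Not (All (Not phi))) v).2 => /(_ x); apply.
  by rewrite (_ : _ \o v = c).
exists (\val y); first exact: set_valP.
have := (elementary_map_fin Mmod phi (extend v y)).1 yP.
by rewrite (_ : _ \o _ = extend c (\val y)) //; apply/funext => -[].
Qed.

Lemma witness_closed_model (N : substructure C) : witness_closed N -> is_model N.
Proof.
(* A quantifier adds a variable, so the induction runs over all variable types that embed in some
   ['I_k], where [witness_closed] applies. *)
move=> Nw; suff h V (phi : formula L V) :
    (exists k (g : V -> 'I_k) (h : 'I_k -> V), cancel g h) ->
    forall v : V -> induced N, sat phi v <-> sat phi ((fun x : induced N => \val x : C) \o v).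
  by move=> k phi v; apply: h; exists k, id, id.
have evalE W (t : term L W) (v : W -> induced N) :
    \val (eval v t) = eval ((fun x : induced N => \val x : C) \o v) t.
  by elim: t => //= f u IH; congr fint; apply/funext.
elim: phi => {V} [V|V s t|V r t|V phi IH psi IH'|V phi IH] Vfin v //=.
- by rewrite -!evalE; split=> [->//|/val_inj].
- by under [in X in _ <-> X]eq_fun do rewrite -evalE.
- by rewrite IH // IH'.
have [k [g [h gK]]] := Vfin.
have {}IH w : sat phi w <-> sat phi ((fun x : induced N => \val x : C) \o w).
  apply: IH; exists k.+1, (fun o => if o is Some x then lift ord0 (g x) else ord0),
    (fun i => omap h (unlift ord0 i)) => -[x|] /=; first by rewrite liftK /= gK.
  by rewrite unlift_none.
have E x : (fun x : induced N => \val x : C) \o extend v x =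
    extend ((fun x : induced N => \val x : C) \o v) (\val x) by apply/funext => -[].
split=> [Nphi x|Cphi x]; last by apply/IH; rewrite E.
apply: contrapT => nphi.
pose c := (fun x : induced N => \val x : C) \o v \o h.
have cE y : extend c y \o omap g = extend ((fun x : induced N => \val x : C) \o v) y.
  by apply/funext => -[z|] //=; rewrite /c /= gK.
have [||y Ny] := @Nw k (Not (rename (omap g) phi)) c.
- by move=> j; apply: set_valP.
- by exists x; rewrite sat_Not sat_rename cE.
rewrite sat_Not sat_rename cE; apply.
by have /IH := Nphi (exist _ y (mem_set Ny)); rewrite E.
Qed.

Lemma models_elementary_sub (N M : substructure C) :
  is_model N -> is_model M -> univ N `<=` univ M -> elementary_sub N M.
Proof.
move=> Nmod Mmod NM; exists NM => k phi v.
pose f : induced N -> induced M := Defs.incl NM.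
apply: iff_trans (Nmod k phi v) (iff_sym _).
exact: (Mmod k phi (f \o v)).
Qed.

(** Each stage [h k] lists elements of [M] along [X]: stage 0 covers [B], and stage [k.+1] has
    witnesses for the formulas with parameters in stage [k], found in [M] because [M] is a model.
    [N] is the union of the stages. *)
Lemma downward_Lowenheim_Skolem (M : substructure C) (B : set C) (X : Type) :
  is_model M -> B `<=` M -> [set: formula L nat] #<= [set: X] -> B #<= [set: X] ->
  exists N : substructure C,
    [/\ B `<=` N, is_model N, elementary_sub N M & univ N #<= [set: X]].
Proof.
move=> Mmod BM LX BX.
have natX : [set: nat] #<= [set: X] by apply: card_le_trans (nat_le_formulas L) LX.
have [[pt Mpt0]] := univ_nonempty M; have Mpt := set_mem Mpt0.
move/card_leT_injP: (natX) => [iX _]; pose l0 := iX 0.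
have [dec decP] : exists dec : X -> formula L nat * seq X, forall q, exists l, dec l = q.
  have /card_leT_injP[code codei] : [set: formula L nat * seq X] #<= [set: X].
    by apply: card_le_trans (card_le_square natX); apply: card_le_prod => //; apply: card_le_seq.
  have /choice[dec decP] : forall l, exists q, forall q', code q' = l -> q = q'.
    move=> l; have [[q ql]|nq] := pselect (exists q, code q = l).
      by exists q => q' q'l; apply: codei; rewrite ql.
    by exists (Bot, [::]) => q' q'l; case: nq; exists q'.
  by exists dec => q; exists (code q); apply: decP.
have [b bM bB] : exists2 b : X -> C, (forall l, univ M (b l)) & forall x, B x -> exists l, b l = x.
  have [h hi] := (card_le_injP B l0).1 BX.
  have /choice[b bP] : forall l, exists x, univ M x /\ forall y, B y -> h y = l -> x = y.
    move=> l; have [[x [Bx xl]]|nx] := pselect (exists x, B x /\ h x = l).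
      exists x; split; first exact: BM.
      by move=> y By yl; apply: hi; rewrite ?xl //; apply: mem_set.
    by exists pt; split=> // y By yl; case: nx; exists y.
  exists b => [l|x Bx]; first by case: (bP l).
  by exists (h x); apply: (bP _).2.
(* Variable 0 is the witness, and the next variables read off the parameters. *)
have /choice[wit witP] : forall q : formula L nat * seq C, exists x, univ M x /\
    ((exists2 y, univ M y & sat q.1 (nth pt (y :: q.2))) -> sat q.1 (nth pt (x :: q.2))).
  move=> q; have [[y My yP]|nq] := pselect (exists2 y, univ M y & sat q.1 (nth pt (y :: q.2))).
    by exists y.
  by exists pt.
pose h := fix h k l := if k is k'.+1 then wit ((dec l).1, map (h k') (dec l).2) else b l.
have hM k l : univ M (h k l) by case: k => [|k] //=; case: (witP ((dec l).1, map (h k) (dec l).2)).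
have hmono k k' l : k <= k' -> exists l', h k' l' = h k l.
  elim: k' => [|k' IH]; first by rewrite leqn0 => /eqP ->; exists l.
  rewrite leq_eqVlt => /orP[/eqP ->|]; first by exists l.
  rewrite ltnS => /IH[l' <-].
  (* The only witness of [v_0 = v_1] is the parameter itself, which therefore reappears at the next
     stage. *)
  have [l'' l''P] := decP (Eq (Var 0) (Var 1), [:: l']).
  exists l''; rewrite /= l''P /=.
  have [_] := witP (Eq (Var 0) (Var 1), [:: h k' l']); apply.
  by exists (h k' l').
pose N := \bigcup_k range (h k).
have NM : N `<=` M by move=> x [k _ [l _ <-]].
have Nw : witness_closed N.
  move=> k phi c Nc cex.
  have [x0 Mx0 x0P] := model_witness_closed Mmod (fun j => NM _ (Nc j)) cex.
  have /choice[K KP] : forall j, exists K, exists l, h K l = c j.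
    by move=> j; have [K _ [l _ e]] := Nc j; exists K, l.
  pose K0 := \max_j K j.
  have /choice[l lP] : forall j, exists l, h K0 l = c j.
    by move=> j; have [l <-] := KP j; apply: hmono; apply: leq_bigmax.
  pose g (o : option 'I_k) : nat := if o is Some j then (val j).+1 else 0.
  pose t := [seq l j | j <- enum 'I_k].
  have gE x : nth pt (x :: map (h K0) t) \o g = extend c x.
    apply/funext => -[j|] //=; rewrite -map_comp (nth_map j) ?size_enum_ord //=.
    by rewrite nth_ord_enum.
  have [lw lwP] := decP (rename g phi, t).
  exists (h K0.+1 lw); first by exists K0.+1 => //; exists lw.
  rewrite /= lwP /=; have [_ /=] := witP (rename g phi, map (h K0) t).
  by rewrite !sat_rename gE; apply; exists x0 => //; rewrite sat_rename gE.
have Nfun (f : Defs.fsym L) (a : 'I_(farity f) -> C) : (forall i, N (a i)) -> N (fint a).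
  (* [fint a] is the only witness of [x = f(a)]. *)
  move=> Na; have [|x Nx] := Nw _
    (Eq (@Var L (option _) None) (App f (fun i => Var (Some i)))) a Na.
    by exists (fint a).
  by move=> /= <-.
have Nne : inhabited N.
  by constructor; exists (h 0 l0); apply: mem_set; exists 0 => //; exists l0.
pose N' := Substructure Nne Nfun.
have Nmod : is_model N' by apply: witness_closed_model.
exists N'; split=> //.
- by move=> x /bB[l <-]; exists 0 => //; exists l.
- exact: models_elementary_sub.
- apply: card_bigcup_le => // k.
  exact: card_image_le.
Qed.

End LowenheimSkolem.

(** * Isolating over a small base *)

Section Codense.
Variables (L : language) (C : structure L) (n : nat).

(** The failure of isolation: no consistent formula over [B] implies [phi(x, c)]. *)
Definition codense m (phi : formula L ('I_n + 'I_m)) (c : 'I_m -> C) (B : set C) : Prop :=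
  forall D, definable_over B D -> D !=set0 -> (D `\` solutions phi c) !=set0.

Lemma codense_sub m (phi : formula L ('I_n + 'I_m)) c (B B' : set C) :
  B `<=` B' -> codense phi c B' -> codense phi c B.
Proof. by move=> BB' cB' D /(definable_sub BB'); apply: cB'. Qed.

(** Each region that a sign pattern on [cs] cuts out of [D] is definable over [B], so codensity
    leaves it a point outside [solutions phi c]. *)
Lemma shatters_setD m (phi : formula L ('I_n + 'I_m)) c (B : set C) cs D :
  codense phi c B -> (forall c', List.In c' cs -> forall j, B (c' j)) ->
  definable_over B D -> shatters phi cs D -> shatters phi cs (D `\` solutions phi c).
Proof.
move=> cB; elim: cs D => [|c' cs IH] D csB Ddef /=; first exact: cB.
have c'def : definable_over B (solutions phi c').
  by apply: definable_inst; apply: csB; left.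
have {}csB : forall c', List.In c' cs -> forall j, B (c' j) by move=> d hd; apply: csB; right.
move=> [pos neg]; split.
  by rewrite setIC setIDA; rewrite setIC in pos; apply: IH => //; apply: definableI.
by rewrite setDDl setUC -setDDl; apply: IH => //; apply: definableD.
Qed.

Lemma definable_list (B : set C) (s : seq (pformula C n)) :
  (forall th, List.In th s -> pformulas_over B th) ->
  definable_over B [set a | forall th, List.In th s -> psat th a].
Proof.
elim: s => [|th s IH] sB.
  rewrite (_ : [set a | _] = setT); first exact: definableT.
  by apply/seteqP; split=> // a _ th [].
rewrite (_ : [set a | _] = [set a | psat th a] `&`
    [set a | forall th, List.In th s -> psat th a]); last first.
  apply/seteqP; split=> a /= => [h|[h h'] th' [<-//|]]; last exact: h'.
  by split=> [|th' h']; apply: h; [left|right].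
apply: definableI; last by apply: IH => th' h; apply: sB; right.
by apply/definable_overP; exists th => //; apply: sB; left.
Qed.

(** Tuples are chosen from the highest level down: the tail [cs] comes from the case [k.+1], and [X]
    gathers its finitely many parameters, which enter the base over which the next [c] is
    codense. *)
Lemma shatters_levels (p : set (pformula C n)) (A : set C) m
    (phi : formula L ('I_n + 'I_m)) (E : nat -> set C) :
  consistent p -> (forall k, E k `<=` E k.+1) -> (forall k, E k `<=` A) ->
  (forall k (X : set C), finite_set X -> X `<=` A -> exists c,
     [/\ forall j, E k.+1 (c j), p (inst phi c) & codense phi c (E k `|` X)]) ->
  forall N k, exists cs X, [/\ size cs = N, finite_set X, X `<=` A,
    forall c, List.In c cs -> forall j, X (c j) &
    forall s, (forall th, List.In th s -> p th /\ pformulas_over (E k) th) ->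
      shatters phi cs [set a | forall th, List.In th s -> psat th a]].
Proof.
move=> pcons Emono EA Eex; elim=> [|N IH] k.
  exists [::], set0; split=> // s sp /=.
  have [|a aP] := pcons _ (finite_In s); last by exists a.
  by move=> th /sp[].
have [cs [X [sz Xfin XA csX csP]]] := IH k.+1.
have [c [cE pc cc]] := Eex k X Xfin XA.
exists (c :: cs), (X `|` range c); split.
- by rewrite /= sz.
- by rewrite finite_setU; split=> //; apply: finite_image; apply: finite_finset.
- by move=> x [/XA//|[j _ <-]]; apply: EA (cE j).
- by move=> c' [<-|/csX h] j; [right; exists j | left].
move=> s sp /=; split.
  (* Positive half: [phi(x, c)] is a formula of [p] over [E k.+1], so it joins the list handled by
     the induction hypothesis. *)
  have := csP (inst phi c :: s); rewrite (_ : [set a | _] =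
    [set a | forall th, List.In th s -> psat th a] `&` solutions phi c); last first.
    apply/seteqP; split=> a /= => [h|[h h'] th [<-|]]; last exact: h.
      by split=> [th hth|]; [apply: h; right | apply/psat_inst; apply: h; left].
    exact/psat_inst.
  apply=> th [<-|/sp[pth [l [psi [d [dE th_inst]]]]]].
    by split=> //; exists m, phi, c.
  by split=> //; exists l, psi, d; split=> // j; apply: Emono.
(* Negative half: codensity of [c] over [E k] and [X]. *)
apply: shatters_setD cc _ _ _.
- by move=> c' /csX h j; right.
- apply: (@definable_sub _ _ _ (E k)); first by left.
  by apply: definable_list => th /sp[].
apply: csP => th /sp[pth [l [psi [d [dE th_inst]]]]].
by split=> //; exists l, psi, d; split=> // j; apply: Emono.
Qed.

End Codense.

(** * Existence of an isolating base of size below [mu] *)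

Section Core.
Variables (L : language) (C : structure L) (kbar : cardinal).
Hypotheses (Csat : saturated C kbar) (hNIP : NIP C).
Variables (A : set C) (hA : small kbar A).
Variables (mu kappa : cardinal) (hmu : A #= [set: mu]).
Hypotheses (hcf : is_cofinality mu kappa)
  (hTkappa : card_lt (formulas L) [set: kappa])
  (hkappamu : card_lt [set: kappa] [set: mu]).

Let nat_kappa : [set: nat] #<= [set: kappa].
Proof. by apply: card_le_trans (nat_le_formulas L) hTkappa.1. Qed.

Lemma nat_lt_kbar : card_lt [set: nat] [set: kbar].
Proof.
apply: card_le_lt_trans hA; apply: card_le_trans nat_kappa _.
exact: card_le_trans hkappamu.1 (card_eqW hmu).2.
Qed.

(** A set without strict upper bound is cofinal, hence has at least [kappa] elements. *)
Lemma bounded_of_small_card (X : set mu) :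
  ~ ([set: kappa] #<= X) -> exists b, forall x, X x -> olt x b.
Proof.
move=> kX; apply: contrapT => /forallNP nb; apply: kX; apply: hcf.2 => b.
have /existsNP[x /not_implyP[Xx xb]] := nb b.
by exists x => //; case: (olt_total x b) => [//|[->|]]; [left|right].
Qed.

Lemma isolating_base n (p : set (pformula C n)) :
  p `<=` pformulas_over A -> consistent p ->
  exists B : set C, [/\ B `<=` A, card_lt B [set: mu] &
    forall theta, p theta -> exists D, [/\ definable_over B D, D !=set0 &
      forall a, D a -> psat theta a]].
Proof.
move=> pA pcons; apply: contrapT => nB.
have bad B : B `<=` A -> card_lt B [set: mu] ->
    exists m (phi : formula L ('I_n + 'I_m)) c,
    [/\ forall j, A (c j), p (inst phi c) & codense phi c B].
  move=> BA Bmu; apply: contrapT => nbad; apply: nB; exists B; split=> // theta ptheta.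
  have [m [phi [c [Ac thE]]]] := pA _ ptheta.
  apply: contrapT => nD; apply: nbad; exists m, phi, c; split=> //; first by rewrite -thE.
  move=> D Ddef Dne; apply: contrapT => DP; apply: nD; exists D; split=> // a Da.
  rewrite thE psat_inst; apply: contrapT => na; apply: DP; by exists a.
have [x0 _] : exists x0 : mu, True.
  have /card_leT_injP[i _] := card_le_trans nat_kappa hkappamu.1.
  by exists (i 0).
have [e ei] := (card_le_injP A x0).1 (card_eqW hmu).1.
(* [e] transports the well-order of [mu] to [A], and [olt_initial] bounds the size of initial
   segments. *)
pose seg al := [set a | A a /\ olt (e a) al].
have segA al : seg al `<=` A by move=> a [].
have seg_mono al be : olt al be -> seg al `<=` seg be.
  by move=> ab a [Aa ea]; split=> //; apply: olt_trans ea ab.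
have seg_lt al : card_lt (seg al) [set: mu].
  apply: card_le_lt_trans (olt_initial al).
  have /card_eqW[_ h] : e @` seg al #= seg al.
    by apply: inj_card_eq => x y /set_mem[Ax _] /set_mem[Ay _]; apply: ei; apply: mem_set.
  by apply: card_le_trans h _; apply: subset_card_le => _ [a [_ ea] <-].
have [K Kunb Kkappa] := hcf.1.
have [kK Kk] := card_eqW Kkappa.
pose good (phi : {m & formula L ('I_n + 'I_m)}) al be (X : set C) :=
  exists c, [/\ forall j, seg be (c j), p (inst (projT2 phi) c) &
    codense (projT2 phi) c (seg al `|` X)].
(* Otherwise each [phi] fails at some [al phi]. These are bounded by [b], as there are fewer than
   [kappa] formulas; [B] collects [seg b] and a counterexample [X q] for each formula and each [be]
   in the cofinal set [K]. *)
have [[m phi] levels] : exists phi, forall al, exists be, forall X,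
    finite_set X -> X `<=` A -> good phi al be X.
  apply: contrapT => /forallNP nlev.
  have /choice[al alP] : forall phi, exists al, forall be, exists X,
      [/\ finite_set X, X `<=` A & ~ good phi al be X].
    move=> phi; have /existsNP[al /forallNP h] := nlev phi; exists al => be.
    by have /existsNP[X /not_implyP[? /not_implyP[? ?]]] := h be; exists X.
  have [b bP] : exists b, forall phi, olt (al phi) b.
    have [kal|b bP] := @bounded_of_small_card (range al); last first.
      by exists b => phi; apply: bP; exists phi.
    apply: hTkappa.2; apply: card_le_trans kal _.
    apply: card_le_trans (card_image_le _ _) _.
    exact: card_formulas_split.
  have /choice[X XP] : forall q : {m & formula L ('I_n + 'I_m)} * K, exists X,
      [/\ finite_set X, X `<=` A & ~ good q.1 (al q.1) (\val q.2) X].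
    by move=> q; apply: alP.
  pose B := seg b `|` \bigcup_q X q.
  have BA : B `<=` A.
    by move=> x [/segA//|[q _]]; have [_ h _] := XP q; apply: h.
  have Bmu : card_lt B [set: mu].
    have [W [segW kW Wmu]] : exists W : Type, [/\ [set: seg b] #<= [set: W],
        [set: kappa] #<= [set: W] & card_lt [set: W] [set: mu]].
      apply: card_lt_sup => //; apply: card_le_lt_trans (seg_lt b).
      exact: (card_eqW (card_setT _)).1.
    have natW := card_le_trans nat_kappa kW.
    apply: card_le_lt_trans Wmu; apply: card_setU_le => //.
      by apply: card_le_trans segW; apply: (card_eqW (card_setT _)).2.
    apply: card_bigcup_le => //.
      apply: card_le_trans (card_le_square natW); apply: card_le_prod.
        apply: card_le_trans (card_formulas_split L n) _.
        exact: card_le_trans hTkappa.1 kW.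
      apply: card_le_trans (card_eqW (card_setT _)).1 _.
      exact: card_le_trans kK kW.
    by move=> q; apply: card_le_trans natW; apply: finite_set_countable; case: (XP q).
  have [m [phi [c [Ac pc cB]]]] := bad B BA Bmu.
  (* The finitely many entries of [c] lie below some [be] in [K], so codensity over [B] contradicts
     the choice of [X q]. *)
  have [kc|be0 be0P] := @bounded_of_small_card (range (e \o c)).
    have : finite_set (range (e \o c)) by apply: finite_image; apply: finite_finset.
    by apply/infiniteP; apply: card_le_trans kc.
  have [be Kbe be0be] := Kunb be0.
  pose q : {m & formula L ('I_n + 'I_m)} * K := (existT _ m phi, exist _ be (mem_set Kbe)).
  have [_ _] := XP q; apply; exists c; split=> //=.
    move=> j; split=> //; have h : olt (e (c j)) be0 by apply: be0P; exists j.
    by case: be0be => [<-//|]; apply: olt_trans.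
  apply: codense_sub cB => x [|Xx]; last by right; exists q.
  by move/(seg_mono _ _ (bP _)); left.
have [f fP] := choice levels.
(* Taking the later of [lv k'] and [f (lv k')] keeps the levels increasing. *)
pose lv := fix lv k := if k is k'.+1
  then (if `[< olt (lv k') (f (lv k')) >] then f (lv k') else lv k') else x0.
have lv_mono k : seg (lv k) `<=` seg (lv k.+1).
  by move=> /=; case: asboolP => // /seg_mono.
have lv_f k : seg (f (lv k)) `<=` seg (lv k.+1).
  move=> /=; case: asboolP => // nlt.
  by case: (olt_total (lv k) (f (lv k))) => [//|[<-//|/seg_mono]].
apply: (hNIP (phi := swap_vars phi)).
apply: (shattered_independence Csat nat_lt_kbar) => N.
have [||k X Xfin XA|cs [_ [sz _ _ _ csP]]] :=
    @shatters_levels _ _ _ p A m phi (fun k => seg (lv k)) pcons _ _ _ N 0.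
- exact: lv_mono.
- by move=> k; apply: segA.
- have [c [cf pc cc]] := fP (lv k) X Xfin XA.
  by exists c; split=> // j; apply: lv_f.
(* With no formula of [p] imposed, the whole space is shattered. *)
exists cs => //; have := csP [::]; rewrite (_ : [set a | _] = setT); first by apply=> th [].
by apply/seteqP; split=> // a _ th [].
Qed.

End Core.

(* If a consistent formula over B implies phi(x, c), it implies phi(x, c') for
   every c' with the same type over B as c. *)
Lemma isolated_not_dividing (L : language) (C : structure L) n m
    (phi : formula L ('I_n + 'I_m)) (c : 'I_m -> C) (B : set C) (D : set ('I_n -> C)) :
  definable_over B D -> D !=set0 -> (forall a, D a -> psat (inst phi c) a) ->
  ~ formula_divides phi c B.
Proof.
move=> /definable_overP[_ [l [psi [b [Bb ->]]]] DP] [a Da] Dphi [cs [ind cs0 ncons]].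
pose g (x : 'I_n + 'I_l) : 'I_n + ('I_1 * 'I_m + 'I_l) :=
  match x with inl i => inl i | inr j => inr (inr j) end.
pose h (x : 'I_n + 'I_m) : 'I_n + ('I_1 * 'I_m + 'I_l) :=
  match x with inl i => inl i | inr j => inr (inl (ord0, j)) end.
(* [chi(y, b)] says that [psi(x, b)] implies [phi(x, y)]; indiscernibility for single members of the
   sequence carries it from [cs 0] to [cs i], so the same [a] satisfies every instance. *)
have [chi chiP] := All_block (Imp (rename g psi) (rename h phi)).
pose val k (v : 'I_1 * 'I_m + 'I_l) : C :=
  match v with inl (s, t) => cs k t | inr u => b u end.
have chiE k : sat chi (val k) <-> forall a, D a -> psat (inst phi (cs k)) a.
  have gE a' : sumv a' (val k) \o g = sumv a' b by apply/funext => -[].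
  have hE a' : sumv a' (val k) \o h = sumv a' (cs k) by apply/funext => -[].
  by rewrite chiP; split=> H a' => [/DP/psat_inst|] /=; have /= := H a';
     rewrite !sat_rename gE hE -!psat_inst -DP.
apply: ncons => F _ FS; exists a => _ /FS[i _ <-].
have [||to _] := ind 1 l chi b Bb (fun=> 0) (fun=> i).
- by move=> s t; rewrite !ord1.
- by move=> s t; rewrite !ord1.
have chi0 : sat chi (val 0) by apply/chiE; rewrite cs0.
by have /chiE := to chi0; apply.
Qed.

(** That [D] is nonempty is expressed with parameters in [N], so elementarity yields a witness in
    [N]. *)
Lemma model_realizes_definable (L : language) (C : structure L) n
    (N : substructure C) (D : set ('I_n -> C)) :
  is_model N -> definable_over N D -> D !=set0 ->
  exists2 a, forall i, univ N (a i) & D a.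
Proof.
move=> Nmod [F [phi [c [Nc DP]]]] [a0 /DP a0P].
have [psi psiP] := Ex_block phi.
pose v j : induced N := exist _ (c j) (mem_set (Nc j)).
have /psiP[a aP] : sat psi v.
  by apply/(elementary_map_fin Nmod)/psiP; exists a0.
exists (fun i => \val (a i)); first by move=> i; apply: set_valP.
apply/DP; have /(elementary_map_fin Nmod) := aP.
by rewrite sumv_comp.
Qed.

Theorem theorem5p1 (L : language) (T : theory L) (hT : complete_theory T)
    (C : structure L) (kbar : cardinal) (hC : monster C T kbar)
    (hNIP : NIP C)
    (A : set C) (hA : small kbar A)
    (mu kappa : cardinal) (hmu : A #= [set: mu])
    (hcf : is_cofinality mu kappa)
    (hTkappa : card_lt (formulas L) [set: kappa])
    (hkappamu : card_lt [set: kappa] [set: mu])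
    (n : nat) (p : set (pformula C n)) (hp : complete_type A p) :
  (exists B : set C,
     [/\ B `<=` A, card_lt B [set: mu] & ~ divides p B]) /\
  (forall M : substructure C, is_model M -> univ M = A ->
     exists N : substructure C,
       [/\ elementary_sub N M, card_lt (univ N) [set: mu] &
           finitely_satisfiable_in p (univ N)]).
Proof.
have [_ Csat _] := hC; have [pA pcons _] := hp.
have [B [BA Bmu Bp]] :=
  isolating_base Csat hNIP hA hmu hcf hTkappa hkappamu pA pcons.
split.
  exists B; split=> // -[m [phi [c [pc]]]].
  by have [D [Ddef Dne Dphi]] := Bp _ pc; apply: isolated_not_dividing Ddef Dne Dphi.
move=> M Mmod MA.
(* [W] bounds both [B] and the number of formulas, so the submodel built along it has size below
   [mu]. *)
have [W [BW LW Wmu]] : exists W : Type, [/\ [set: B] #<= [set: W],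
    [set: formula L nat] #<= [set: W] & card_lt [set: W] [set: mu]].
  apply: card_lt_sup; first exact: card_le_lt_trans (card_eqW (card_setT B)).1 Bmu.
  exact: card_le_lt_trans hTkappa.1 hkappamu.
have [||N [BN Nmod NM NW]] := downward_Lowenheim_Skolem Mmod _ LW _ (B := B).
- by rewrite MA.
- exact: card_le_trans (card_eqW (card_setT B)).2 BW.
exists N; split=> //; first exact: card_le_lt_trans NW Wmu.
(* The isolating set [D] is definable over [N], so it has a point in [N], and that point satisfies
   [theta]. *)
move=> theta /Bp[D [Ddef Dne Dth]].
have [a Na /Dth] := model_realizes_definable Nmod (definable_sub BN Ddef) Dne.
by exists a.
Qed.
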